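(* Let $\epsilon=2\times 10^{-8}$, $\delta=2\times 10^{-6}$, $s=2\times 10^{-4}$, $d\ge1/\epsilon$ an integer, $G=(V,E)$ a graph, and $K=(V,E_K)$ an $(\epsilon,d)$-kernel of $G$ with $\mu(G)\ge(2-\delta)\mu(K)$. Let $\{d^u(v)\mid u,v\in V\}$ be $\epsilon^2 d$-approximate degrees in $K$. For each $i\in\{1,\dots,1/\epsilon\}$ let $M_H^{(i)}$ and $M_{SH}^{(i)}$ be $(3/2+\epsilon)$-approximate matchings in $B_H^{(i)}$ and $B_{SH}^{(i)}$, respectively, and let $A=\bigcup_{i=1}^{1/\epsilon}(M_H^{(i)}\cup M_{SH}^{(i)})$. Then $\mu(G)\le(2-\delta)\cdot\mu(G[E_K\cup A])$.
   Context: $\mu(\cdot)$ is maximum matching size; $d_K(v)$ the degree of $v$ in $K$; $G[F]$ is the subgraph with edge set $F$. An $(\epsilon,d)$-kernel of $G=(V,E)$ is a subgraph $K=(V,E_K)$, $E_K\subseteq E$, with (P1) $d_K(v)\le d$ for all $v$ and (P2) every $e\in E\setminus E_K$ has an endpoint of $K$-degree at least $d(1-\epsilon)$. Numbers $\{d^u(v)\}$ are $\alpha$-approximate degrees in $K$ if $d_K(v)-\alpha\le d^u(v)\le d_K(v)+\alpha$ for all $u,v$. $B_H^{(i)}$ (resp. $B_{SH}^{(i)}$) is the subgraph of $G$ consisting of the edges $(u,v)\in E$ with $d^u(v)\ge d(1-2s-i\epsilon^2)$ (resp. $d^u(v)\ge d(1-\epsilon-i\epsilon^2)$) and $d^v(u)\le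 d(s+i\epsilon^2)$; these are bipartite. A matching is $\beta$-approximate in $H$ if its size is at least $\mu(H)/\beta$. The assumption $\mu(G)\ge(2-\delta)\mu(K)$ is a standing assumption of the section. *)

(* Defs.v *)
From mathcomp Require Import all_boot all_order all_algebra.

Set Implicit Arguments.
Unset Strict Implicit.
Unset Printing Implicit Defensive.

Import Order.TTheory GRing.Theory Num.Theory.
Local Open Scope ring_scope.

(* A graph on V is given by its set of edges, each edge being a set of vertices.
   Subgraphs share the vertex set V, so G[F] is represented by F itself. *)
Definition simple_graph (V : finType) (E : {set {set V}}) : Prop :=
  forall e : {set V}, e \in E -> #|e| = 2%N.

Definition deg (V : finType) (F : {set {set V}}) (v : V) : nat :=
  #|[set e in F | v \in e]|.

Definition is_matching (V : finType) (F M : {set {set V}}) : bool :=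
  (M \subset F) && trivIset M.

Definition mu (V : finType) (F : {set {set V}}) : nat :=
  (\max_(M : {set {set V}} | is_matching F M) #|M|)%N.

Definition approx_matching (R : realFieldType) (V : finType) (beta : R)
    (F M : {set {set V}}) : Prop :=
  is_matching F M /\ (mu F)%:R / beta <= #|M|%:R.

Definition is_kernel (R : realFieldType) (V : finType) (eps : R) (d : nat)
    (E EK : {set {set V}}) : Prop :=
  [/\ EK \subset E,
      forall v : V, (deg EK v <= d)%N
    & forall e : {set V}, e \in E :\: EK ->
        exists2 v : V, v \in e & d%:R * (1 - eps) <= (deg EK v)%:R].

(* du u v is the number d^u(v). *)
Definition approx_degrees (R : realFieldType) (V : finType) (alpha : R)
    (EK : {set {set V}}) (du : V -> V -> R) : Prop :=
  forall u v : V, (deg EK v)%:R - alpha <= du u v <= (deg EK v)%:R + alpha.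

(* Edges are unordered: an edge is kept as soon as one of its two orientations
   (u, v) satisfies both inequalities. *)
Definition threshold_subgraph (R : realFieldType) (V : finType)
    (E : {set {set V}}) (du : V -> V -> R) (hi lo : R) : {set {set V}} :=
  [set e in E | [exists u : V, exists v : V,
     [&& e == [set u; v], hi <= du u v & du v u <= lo]]].

Definition BH (R : realFieldType) (V : finType) (eps s : R) (d : nat)
    (E : {set {set V}}) (du : V -> V -> R) (i : nat) : {set {set V}} :=
  threshold_subgraph E du
    (d%:R * (1 - 2 * s - i%:R * eps ^+ 2)) (d%:R * (s + i%:R * eps ^+ 2)).

Definition BSH (R : realFieldType) (V : finType) (eps s : R) (d : nat)
    (E : {set {set V}}) (du : V -> V -> R) (i : nat) : {set {set V}} :=
  threshold_subgraph E du
    (d%:R * (1 - eps - i%:R * eps ^+ 2)) (d%:R * (s + i%:R * eps ^+ 2)).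

(* Main.v *)
(* Only the matching M_H^(1) is needed. Let M be a maximum matching of G. Give
   weight 1/d to every edge of K outside M, and to an edge uv of K in M the weight
   1 - (max(d_K(u), d_K(v)) - 1)/d. This is a fractional matching of K, and by the
   Tutte-Berge formula its value is at most (1 + 1/d) mu(K): a component with
   2k + 1 vertices has a vertex avoiding the M-edges inside it, whose load from
   the component is at most 2k/d. On the other hand the two endpoints of every
   edge of M have total load at least 1 - eps, and at least 1 - eps + s unless one
   endpoint has degree at least d(1 - 2s) and the other at most ds. As mu(G) is
   almost 2 mu(K), all but a fraction of about (delta + 4 eps)/(2s) of the edges of
   M are therefore of this unbalanced kind and lie in B_H^(1). So M_H^(1) alone has
   about (2/3) mu(G) edges. *)
Require Import Defs.
From mathcomp Require Import all_boot all_order all_algebra.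
From mathcomp Require Import zify ring lra.

Import Order.TTheory GRing.Theory Num.Theory.
Local Open Scope ring_scope.

Lemma card_set_filter (T : finType) (A : {set T}) (P : pred T) :
  #|[set x in A | P x]| = (\sum_(x in A) P x)%N.
Proof.
rewrite -sum1_card (eq_bigl (fun x => (x \in A) && P x)) => [|x]; last by rewrite inE.
by rewrite big_mkcondr.
Qed.

(** * Maximum matchings, Gallai's lemma and the Tutte-Berge bound *)

Section Matchings.
Local Open Scope nat_scope.
Variable V : finType.
Implicit Types (F M N : {set {set V}}) (e : {set V}) (u v : V).

Lemma edge_endpoint e v : #|e| = 2 -> v \in e -> exists2 w, w != v & e = [set v; w].
Proof.
move=> e2 ve; have /cards1P[w ew] : #|e :\ v| == 1.
  by move: (cardsD1 v e); rewrite ve e2 add1n => -[<-].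
exists w; first by have := set11 w; rewrite -ew !inE => /andP[].
by rewrite -ew setD1K.
Qed.

Lemma matching_le_mu F M : is_matching F M -> #|M| <= mu F.
Proof. by move=> FM; rewrite /mu; apply: leq_bigmax_cond. Qed.

Lemma mu_attained F : exists2 M, is_matching F M & #|M| = mu F.
Proof.
have m0 : is_matching F set0.
  by rewrite /is_matching sub0set; apply/trivIsetP => A B; rewrite inE.
rewrite /mu (bigop.bigmax_eq_arg set0 m0); case: arg_maxnP => // M mM _.
by exists M.
Qed.

Lemma cover_pairs F M : simple_graph F -> is_matching F M -> #|cover M| = #|M|.*2.
Proof.
move=> sF /andP[/subsetP MF /eqP <-].
by rewrite (eq_bigr (fun=> 2)) => [|e /MF/sF //]; rewrite sum_nat_const muln2.
Qed.

Lemma matching_sub F M N : is_matching F M -> N \subset M -> is_matching F N.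
Proof.
move=> /andP[MF tM] NM; rewrite /is_matching (subset_trans NM MF).
exact: trivIsetS tM.
Qed.

Lemma matching_setU1 F M e : e \in F -> is_matching F M -> [disjoint e & cover M] ->
  is_matching F (e |: M).
Proof.
move=> eF /andP[MF /trivIsetP tM] eM.
rewrite /is_matching subUset sub1set eF MF; apply/trivIsetP => A B.
have eA C : C \in M -> [disjoint e & C].
  by move=> CM; apply: disjointWr eM; apply: (bigcup_sup C).
rewrite !inE => /predU1P[->|AM] /predU1P[->|BM]; first by rewrite eqxx.
- by move=> _; apply: eA.
- by move=> _; rewrite disjoint_sym; apply: eA.
- exact: tM.
Qed.

Definition maximum F M := is_matching F M && (#|M| == mu F).

Lemma maximum_covers_edge F M e : simple_graph F -> maximum F M -> e \in F ->
  ~~ [disjoint e & cover M].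
Proof.
move=> sF /andP[mM /eqP cM] eF; apply/negP => eM.
have := matching_le_mu _ _ (matching_setU1 _ _ _ eF mM eM).
suff eNM : e \notin M by rewrite cardsU1 eNM cM add1n ltnn.
apply/negP => eM'; have /card_gt0P[v ve] : 0 < #|e| by rewrite sF.
by move: (disjointFr eM ve); rewrite (subsetP (bigcup_sup e eM') v ve).
Qed.

(** The case [u = v] says that some maximum matching misses [v]. For distinct vertices the negation
    will be the equivalence whose classes serve as components. *)
Definition jointly_missed F u v :=
  [exists M, [&& maximum F M, u \notin cover M & v \notin cover M]].

(* Gallai's lemma: among the maximum matchings N missing t, one that shares the
   most edges with M can still be exchanged towards M. *)
Lemma jointly_missed_trans F u t v : simple_graph F -> u != v ->
  jointly_missed F t t -> jointly_missed F u v ->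
  jointly_missed F u t || jointly_missed F t v.
Proof.
move=> sF uv tt /existsP[M /and3P[maxM uM vM]]; apply: contraT.
rewrite negb_or => /andP[/existsPn ut /existsPn tv].
have tM : t \in cover M.
  by have := ut M; rewrite maxM uM /= negbK.
have [N0 N0P] : exists N, maximum F N && (t \notin cover N).
  by case/existsP: tt => N /and3P[maxN tN _]; exists N; rewrite maxN.
pose missing_t N := maximum F N && (t \notin cover N).
have [N /andP[maxN tN] Nmax] := @arg_maxnP _ N0 missing_t (fun N => #|M :&: N|) N0P.
have uN : u \in cover N by have := ut N; rewrite maxN tN /= andbT negbK.
have vN : v \in cover N by have := tv N; rewrite maxN tN /= negbK.
have [mM /eqP cM] := andP maxM; have [mN /eqP cN] := andP maxN.
(* [M] and [N] cover equally many vertices, and [N] covers both [u] and [v], which [M] misses. So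
   [M] covers at least two vertices missed by [N], one of them other than [t]. *)
have [x] : exists x, x \in (cover M :\: cover N) :\ t.
  apply/card_gt0P.
  have D2 : 1 < #|cover N :\: cover M|.
    apply: leq_trans (_ : #|[set u; v]| <= _); first by rewrite cards2 uv.
    by apply: subset_leq_card; rewrite subUset !sub1set !inE uM vM uN vN.
  have cMN : #|cover M| = #|cover N| by rewrite !(cover_pairs F) // cM cN.
  move: D2; rewrite cardsD setIC -cMN -cardsD (cardsD1 t) !inE tM tN.
  by rewrite add1n ltnS.
rewrite !inE => /and3P[xt xN /bigcupP[e eM xe]].
have [/andP[/subsetP MF /trivIsetP tM'] /andP[/subsetP NF /trivIsetP tN']] := (mM, mN).
have eF := MF _ eM.
have [y yx eE] := edge_endpoint _ _ (sF _ eF) xe.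
have ye : y \in e by rewrite eE !inE eqxx orbT.
have [yN|yN] := boolP (y \in cover N); last first.
  have := maximum_covers_edge _ _ _ sF maxN eF; rewrite disjoints_subset eE.
  by rewrite subUset !sub1set !inE xN yN.
have /bigcupP[f fN yf] := yN.
have eN : e \notin N.
  by apply: contra xN => eN; apply/bigcupP; exists e.
have fM : f \notin M.
  apply/negP => fM; have [ef|ef] := eqVneq e f; first by rewrite ef fN in eN.
  by rewrite (disjointFr (tM' _ _ eM fM ef) ye) in yf.
have yt : y != t by apply: contraNneq tN => <-.
(* Replacing [f] by [e] in [N] keeps it maximum and still missing [t], but adds a common edge with
   [M] since [f] is not in [M]. This contradicts the choice of [N]. *)
have mN' : is_matching F (e |: (N :\ f)).
  apply: matching_setU1 => //; first by apply: matching_sub mN _; apply: subsetDl.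
  rewrite disjoints_subset eE subUset !sub1set !inE; apply/andP; split.
    apply: contra xN => /bigcupP[g]; rewrite !inE => /andP[_ gN] xg.
    by apply/bigcupP; exists g.
  apply/negP => /bigcupP[g]; rewrite !inE => /andP[gf gN] yg.
  by rewrite (disjointFr (tN' _ _ gN fN gf) yg) in yf.
have eNf : e \notin N :\ f by rewrite !inE negb_and eN orbT.
have maxN' : maximum F (e |: (N :\ f)).
  rewrite /maximum mN' cardsU1 eNf /= -cN.
  by have := cardsD1 f N; rewrite fN => ->.
have tN2 : t \notin cover (e |: (N :\ f)).
  apply/negP => /bigcupP[g]; rewrite !inE => /predU1P[->|/andP[_ gN]].
    by rewrite eE !inE eq_sym (negPf xt) eq_sym (negPf yt).
  by move=> tg; case/negP: tN; apply/bigcupP; exists g.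
have := Nmax (e |: (N :\ f)); rewrite /missing_t maxN' tN2 => /(_ isT).
rewrite /geq /= leqNgt => /negP[].
apply: (@leq_trans #|e |: (M :&: N)|).
  by rewrite cardsU1 !inE (negPf eN) andbF.
apply: subset_leq_card; apply/subsetP => g; rewrite !inE.
case/predU1P => [->|/andP[gM gN]]; first by rewrite eqxx eM.
by rewrite gM gN andbT; apply/orP; right; apply: contraNneq fM => <-.
Qed.

Definition fibre (c : V -> {set V}) (r : {set V}) := [set v | c v == r].

(** No edge of [M] crosses between fibres, so a fibre consists of the endpoints of the [M]-edges
    inside it and at most one missed vertex. Half its size, rounded down, counts those edges. *)
Lemma sum_fibre_half_le F M (c : V -> {set V}) :
  simple_graph F -> is_matching F M ->
  (forall e, e \in M -> {in e &, forall u v, c u = c v}) ->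
  (forall r, #|fibre c r :\: cover M| <= 1) ->
  \sum_r #|fibre c r|./2 <= #|M|.
Proof.
move=> sF mM cM missed.
have [/subsetP MF tM] := andP mM.
apply: leq_trans (_ : \sum_r \sum_(e in M) (e \subset fibre c r : nat) <= _).
  apply: leq_sum => r _; set Mr := [set e in M | e \subset fibre c r].
  rewrite -card_set_filter -/Mr.
  have mMr : is_matching F Mr.
    by apply: matching_sub mM _; apply/subsetP => e; rewrite inE => /andP[].
  have := cover_pairs _ _ sF mMr; have := missed r.
  have := cardsID (cover M) (fibre c r).
  have : #|fibre c r :&: cover M| <= #|cover Mr|.
    apply: subset_leq_card; apply/subsetP => v; rewrite !inE.
    case/andP=> /eqP cv /bigcupP[e eM ve]; apply/bigcupP; exists e => //.
    rewrite inE eM; apply/subsetP => w we; rewrite inE.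
    by rewrite (cM e eM w v we ve) cv.
  by lia.
rewrite exchange_big /= -sum1_card; apply: leq_sum => e eM.
have /card_gt0P[v ve] : 0 < #|e| by rewrite (sF _ (MF _ eM)).
rewrite (bigD1 (c v)) //= big1 ?addn0 ?leq_b1 // => r rv; apply/eqP.
rewrite eqb0; apply: contra rv => /subsetP/(_ _ ve).
by rewrite inE eq_sym.
Qed.

(* The hard half of the Tutte-Berge formula; the fibres of [c] outside [U] play
   the role of the components of the graph without [U]. *)
Lemma tutte_berge F : simple_graph F ->
  exists (U : {set V}) (c : V -> {set V}),
    (forall e, e \in F -> [disjoint e & U] -> {in e &, forall u v, c u = c v}) /\
    #|U| + \sum_r #|fibre c r|./2 <= mu F.
Proof.
have [m] := ubnP (mu F); elim: m F => // m IH F muF sF.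
have [|allmissed] := boolP [exists v, ~~ jointly_missed F v v].
  (* A vertex covered by every maximum matching is moved into [U]. Deleting its edges lowers [mu],
     since a matching of the old size would be a maximum matching missing it. *)
  case/existsP=> v vess; pose F' := [set e in F | v \notin e].
  have F'F : F' \subset F by apply/subsetP => e; rewrite inE => /andP[].
  have sF' : simple_graph F' by move=> e /(subsetP F'F)/sF.
  have muF' : mu F' < mu F.
    have [M /andP[MF' tM] cM] := mu_attained F'.
    have mM : is_matching F M by rewrite /is_matching (subset_trans MF').
    rewrite ltn_neqAle -cM matching_le_mu // andbT.
    apply: contra vess => cM'; apply/existsP; exists M.
    rewrite /maximum mM cM' /= andbb; apply/bigcupP => -[e /(subsetP MF')].
    by rewrite inE => /andP[_ /negP].
  have [||U [c [cE cU]]] := IH F'; [exact: leq_trans muF' _ | exact: sF' | ].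
  exists (v |: U), c; split.
    move=> e eF dU; apply: cE; last exact: disjointWr (subsetUr _ _) dU.
    by rewrite inE eF (disjointFl dU) // setU11.
  apply: leq_trans muF'; rewrite cardsU1; apply: leq_trans (_ : 1 + _ <= _); last exact: cU.
  by rewrite -addnA leq_add2r leq_b1.
move: allmissed => /existsPn allmissed.
have missed v : jointly_missed F v v by have := allmissed v; rewrite negbK.
(* Now every vertex is missed by some maximum matching, which is what Gallai's lemma needs to make
   [same] transitive. Its classes are the fibres, and [U] is empty. *)
pose same u v := (u == v) || ~~ jointly_missed F u v.
have same_sym u v : same u v = same v u.
  rewrite /same eq_sym; congr (_ || ~~ _).
  by apply: eq_existsb => M; rewrite [X in _ && X]andbC.
have same_trans u v w : same u v -> same v w -> same u w.
  rewrite /same; have [-> //|uv] := eqVneq u v; have [<-|vw] := eqVneq v w.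
    by rewrite (negPf uv).
  have [//|uw] := eqVneq u w => /= nuv nvw; apply/negP => juw.
  have := jointly_missed_trans _ _ v _ sF uw (missed v) juw.
  by rewrite (negPf nuv) (negPf nvw).
pose c v := [set w | same v w].
have same_c u v : (c u == c v) = same u v.
  apply/eqP/idP => [/setP/(_ v)|uv].
    by rewrite !inE {2}/same eqxx.
  apply/setP => w; rewrite !inE; apply/idP/idP; last exact: same_trans.
  by apply: same_trans; rewrite same_sym.
have cE e : e \in F -> {in e &, forall u v, c u = c v}.
  move=> eF u v ue ve; apply/eqP; rewrite same_c /same.
  have [//|uv /=] := eqVneq u v; apply/negP => /existsP[M /and3P[maxM uM vM]].
  have [w _ eE] := edge_endpoint _ _ (sF _ eF) ue.
  have := maximum_covers_edge _ _ _ sF maxM eF.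
  rewrite disjoints_subset eE subUset !sub1set !inE uM /=.
  by move: ve; rewrite eE !inE eq_sym (negPf uv) /= => /eqP <-; rewrite vM.
exists set0, c; split=> [e eF _|]; first exact: cE.
have [M mM cM] := mu_attained F; rewrite cards0 add0n -cM.
have [/subsetP MF _] := andP mM.
apply: (sum_fibre_half_le F) => // [e /MF/cE //|r].
(* Two vertices of one class both missed by [M] would be jointly missed. *)
rewrite leqNgt; apply/negP => /card_gt1P[u [v [+ + uv]]].
rewrite !inE => /andP[uM /eqP cu] /andP[vM /eqP cv].
have := same_c u v; rewrite cu cv eqxx /same (negPf uv) /= => /esym/existsPn/(_ M).
by rewrite /maximum mM cM eqxx uM vM.
Qed.

End Matchings.

(** * Bounding fractional matchings with small weights by integral ones *)

Section Rounding.
Variables (R : realFieldType) (V : finType).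
Implicit Types (F M : {set {set V}}) (e : {set V}) (x : {set V} -> R).

Definition load F x v : R := \sum_(e in F | v \in e) x e.

Lemma sum_load F x (A : {set V}) :
  \sum_(v in A) load F x v = \sum_(e in F) x e * #|e :&: A|%:R.
Proof.
rewrite /load (eq_bigr (fun v => \sum_(e in F) x e * (v \in e)%:R)); last first.
  by move=> v _; rewrite big_mkcondr; apply: eq_bigr => e _; case: ifP; rewrite ?mulr1 ?mulr0.
rewrite exchange_big; apply: eq_bigr => e _ /=; rewrite -mulr_sumr -natr_sum.
congr (_ * _%:R); rewrite -sum1_card big_mkcond [RHS]big_mkcond.
by apply: eq_bigr => v _; rewrite inE andbC; case: (v \in A); case: (v \in e).
Qed.

(** Deleting [v] sends its edges inside [C] injectively to singletons of [C :\ v]. *)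
Lemma deg_within_le F (C : {set V}) v : simple_graph F -> v \in C ->
  (deg [set e in F | e \subset C] v <= #|C|.-1)%N.
Proof.
move=> sF vC; rewrite /deg.
have -> : #|C|.-1 = #|C :\ v| by rewrite (cardsD1 v C) vC.
rewrite -[leqRHS](card_imset _ set1_inj).
have inj_del : {in [set e in [set e in F | e \subset C] | v \in e] &,
    injective (fun e => e :\ v)}.
  move=> e f; rewrite !inE => /andP[_ ve] /andP[_ vf] ef.
  by rewrite -(setD1K ve) ef setD1K.
rewrite -(card_in_imset inj_del).
apply: subset_leq_card; apply/subsetP => _ /imsetP[e + ->].
rewrite !inE => /andP[/andP[eF eC] ve].
have [w wv eE] := edge_endpoint _ _ _ (sF _ eF) ve.
have -> : e :\ v = [set w].
  apply/setP => u; rewrite eE !inE; have [->|//] := eqVneq u v.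
  by rewrite eq_sym (negPf wv).
apply: imset_f; rewrite !inE wv; apply: (subsetP eC).
by rewrite eE !inE eqxx orbT.
Qed.

(** Twice the weight inside [C] is the sum of the loads inside [C], each at most 1. This suffices
    for even size; for size 2k + 1 one vertex must have load at most 2k [alpha] instead of 1. *)
Lemma weight_within_le F M x (alpha : R) (C : {set V}) :
  simple_graph F -> is_matching F M -> 0 <= alpha ->
  (forall e, e \in F -> 0 <= x e) ->
  (forall e, e \in F :\: M -> x e <= alpha) ->
  (forall v, load F x v <= 1) ->
  \sum_(e in F | e \subset C) x e <= (1 + alpha) * (#|C|./2)%:R.
Proof.
move=> sF mM a0 x0 xa xl.
pose FC := [set e in F | e \subset C].
have FCP e : (e \in FC) = (e \in F) && (e \subset C) by rewrite inE.
have FCl v : load FC x v <= load F x v.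
  rewrite /load big_mkcond [leRHS]big_mkcond; apply: ler_sum => e _.
  rewrite FCP; case: (boolP (e \in F)) => eF //=.
  by case: (e \subset C) => //=; case: ifP => // _; apply: x0.
rewrite -(eq_bigl _ _ FCP).
have dbl : 2 * \sum_(e in FC) x e = \sum_(v in C) load FC x v.
  rewrite sum_load mulr_sumr; apply: eq_bigr => e; rewrite FCP => /andP[eF /setIidPl ->].
  by rewrite sF // mulrC.
have [oddC|evenC] := boolP (odd #|C|); last first.
  have kE : #|C|%:R = (#|C|./2)%:R * 2 :> R.
    by rewrite -natrM muln2 -{1}[#|C|]odd_double_half (negPf evenC).
  have : \sum_(v in C) load FC x v <= \sum_(v in C) 1.
    by apply: ler_sum => v _; apply: le_trans (FCl v) _.
  rewrite -dbl sumr_const kE.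
  have : 0 <= alpha * (#|C|./2)%:R by rewrite mulr_ge0.
  by lra.
(* An odd set has a vertex outside every M-edge it contains; the load of that
   vertex inside C is small. *)
pose MC := [set e in M | e \subset C].
have mMC : is_matching F MC.
  by apply: matching_sub mM _; apply/subsetP => e; rewrite inE => /andP[].
have /subsetPn[v0 v0C v0M] : ~~ (C \subset cover MC).
  apply: contraL oddC => CM; suff -> : C = cover MC.
    by rewrite (cover_pairs _ _ _ sF mMC) odd_double.
  apply/eqP; rewrite eqEsubset CM; apply/bigcupsP => e.
  by rewrite inE => /andP[].
have kE : (#|C|.-1 = #|C|./2.*2)%N by rewrite -{1}[#|C|]odd_double_half oddC.
have l0 : load FC x v0 <= alpha * (#|C|./2)%:R * 2.
  have /le_trans -> // : load FC x v0 <= alpha * (deg FC v0)%:R.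
    rewrite mulr_natr /load /deg -sumr_const.
    rewrite [leRHS](eq_bigl (fun e => (e \in FC) && (v0 \in e))); last first.
      by move=> e; rewrite inE.
    apply: ler_sum => e /andP[]; rewrite FCP => /andP[eF eC] ve.
    apply: xa; rewrite inE eF andbT; apply: contra v0M => eM.
    by apply/bigcupP; exists e => //; rewrite inE eM.
  rewrite -mulrA ler_wpM2l // -natrM ler_nat muln2.
  by rewrite -kE; apply: deg_within_le.
have : \sum_(v in C :\ v0) load FC x v <= \sum_(v in C :\ v0) 1.
  by apply: ler_sum => v _; apply: le_trans (FCl v) _.
have -> : \sum_(v in C :\ v0) 1 = (#|C|./2)%:R * 2 :> R.
  by rewrite sumr_const -natrM muln2 -kE (cardsD1 v0 C) v0C.
rewrite (big_setD1 _ v0C) /= in dbl.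
by lra.
Qed.

(** Take [U] and [c] from Tutte-Berge. Edges meeting [U] are paid for by the loads on [U], at most 1
    per vertex; every other edge lies inside a single fibre. *)
Lemma fractional_matching_le_mu F M x (alpha : R) :
  simple_graph F -> is_matching F M -> 0 <= alpha ->
  (forall e, e \in F -> 0 <= x e) ->
  (forall e, e \in F :\: M -> x e <= alpha) ->
  (forall v, load F x v <= 1) ->
  \sum_(e in F) x e <= (1 + alpha) * (mu F)%:R.
Proof.
move=> sF mM a0 x0 xa xl.
have [U [c [cE cU]]] := tutte_berge _ _ sF.
apply: (@le_trans _ _ ((1 + alpha) * (#|U| + \sum_r #|fibre _ c r|./2)%:R)); last first.
  by rewrite ler_wpM2l ?ler_nat // addr_ge0.
have split_e e : e \in F ->
    x e <= x e * #|e :&: U|%:R + \sum_r (if e \subset fibre _ c r then x e else 0).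
  move=> eF; have xe0 := x0 _ eF.
  have sum0 : 0 <= \sum_r (if e \subset fibre _ c r then x e else 0).
    by apply: sumr_ge0 => r _; case: ifP.
  have [dU|dU] := boolP [disjoint e & U]; last first.
    rewrite -[leLHS]addr0 lerD // ler_peMr // ler1n lt0n cards_eq0.
    by rewrite setI_eq0.
  have /card_gt0P[v ve] : (0 < #|e|)%N by rewrite sF.
  rewrite -[leLHS]add0r lerD ?mulr_ge0 // (bigD1 (c v)) //=.
  have -> : e \subset fibre _ c (c v).
    by apply/subsetP => w we; rewrite inE (cE e eF dU w v we ve).
  by rewrite lerDl; apply: sumr_ge0 => r _; case: ifP.
apply: le_trans (ler_sum _ split_e) _.
rewrite big_split /= -sum_load exchange_big /= natrD mulrDr lerD //.
  apply: (@le_trans _ _ (\sum_(v in U) 1)); first by apply: ler_sum.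
  by rewrite sumr_const ler_peMl // lerDl.
rewrite natr_sum mulr_sumr; apply: ler_sum => r _.
by rewrite -big_mkcondr; apply: (weight_within_le _ _ _ _ _ sF mM).
Qed.

End Rounding.

(** * The fractional matching of the kernel and the count of unbalanced edges *)

Section Kernel.
Variables (R : realFieldType) (V : finType) (eps s : R) (d : nat).
Variables (E EK M : {set {set V}}).
Implicit Types (e : {set V}) (v : V).

(** These are the thresholds of [BH] without the slack in [i], applied to exact degrees. *)
Definition skew e := [exists a, exists b,
  [&& e == [set a; b], d%:R * (1 - 2 * s) <= (deg EK b)%:R
    & (deg EK a)%:R <= d%:R * s]].

(* The largest weight that an edge of M can carry when every other edge of the
   kernel carries 1/d. *)
Definition kernel_weight e : R :=
  if e \in M then 1 - ((\max_(v in e) deg EK v)%:R - 1) / d%:R else d%:R^-1.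

Local Notation y := (load _ _ EK kernel_weight).

Lemma load_unmatched v : v \notin cover (M :&: EK) ->
  y v = (deg EK v)%:R / d%:R.
Proof.
move=> vM; rewrite /load (eq_bigr (fun=> d%:R^-1)).
  rewrite (eq_bigl (mem [set e in EK | v \in e])) => [|e]; last by rewrite !inE.
  by rewrite sumr_const mulr_natl.
move=> e /andP[eK ve]; rewrite /kernel_weight ifN //; apply: contra vM => eM.
by apply/bigcupP; exists e; rewrite // inE eM.
Qed.

Lemma load_matched e v : trivIset M -> e \in M -> e \in EK -> v \in e ->
  y v = kernel_weight e + ((deg EK v)%:R - 1) / d%:R.
Proof.
move=> /trivIsetP tM eM eK ve; pose S := [set f in EK | v \in f].
have eS : e \in S by rewrite inE eK.
rewrite /load (eq_bigl (mem S)) => [|f]; last by rewrite !inE.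
rewrite (big_setD1 e) //=; congr (_ + _).
rewrite (eq_bigr (fun=> d%:R^-1)).
  have cS : #|S| = #|S :\ e|.+1 by rewrite (cardsD1 e) eS.
  by rewrite sumr_const /deg -/S cS -natr1 addrK mulr_natl.
move=> f; rewrite !inE => /and3P[fe fK vf]; rewrite /kernel_weight ifN //.
apply/negP => fM; by rewrite (disjointFr (tM _ _ fM eM fe) vf) in ve.
Qed.

Hypotheses (d_gt0 : (0 < d)%N) (sE : simple_graph E).
Hypotheses (kernelK : is_kernel eps d E EK) (mM : is_matching E M).
Hypotheses (eps_ge0 : 0 <= eps) (eps_le : eps <= 2 * s).

Let D_gt0 : 0 < d%:R :> R. Proof. by rewrite ltr0n. Qed.

Lemma deg_kernel_le v : (deg EK v)%:R <= d%:R :> R.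
Proof. by rewrite ler_nat; case: kernelK. Qed.

Lemma kernel_weight_ge0 e : 0 <= kernel_weight e.
Proof.
rewrite /kernel_weight; case: ifP => _; last by rewrite invr_ge0.
rewrite subr_ge0 ler_pdivrMr // mul1r lerBlDr.
apply: le_trans (_ : d%:R <= _); last by rewrite lerDl.
by rewrite ler_nat; apply/bigmax_leqP => v _; case: kernelK.
Qed.

(** At an endpoint of an edge of [M] in the kernel, the load is 1 - (D - D')/d, with D the larger
    endpoint degree and D' the degree of that endpoint. *)
Lemma load_kernel_weight_le1 v : y v <= 1.
Proof.
have [/bigcupP[e]|vM] := boolP (v \in cover (M :&: EK)); last first.
  by rewrite load_unmatched // ler_pdivrMr // mul1r deg_kernel_le.
rewrite inE => /andP[eM eK] ve; have [_ tM] := andP mM.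
rewrite (load_matched e) // /kernel_weight eM -addrA gerDl addrC subr_le0.
rewrite ler_pM2r ?invr_gt0 // lerB // ler_nat.
exact: leq_bigmax_cond.
Qed.

(** Let D >= D' be the endpoint degrees. The loads add up to 2 - (D - D')/d inside the kernel, and
    to (D + D')/d outside, where (P2) gives D >= d(1 - eps). *)
Lemma matching_edge_load e : e \in M ->
  1 - eps + s * (~~ skew e)%:R <= \sum_(v in e) y v.
Proof.
move=> eM; have [/subsetP ME tM] := andP mM; have eE := ME _ eM.
have /eqP/cards2P[a [b [ab eab]]] := sE _ eE.
have -> : \sum_(v in e) y v = y a + y b.
  by rewrite eab big_setU1 ?inE //= big_set1.
have s0 : 0 <= s * d%:R by apply: mulr_ge0 => //; have := le_trans eps_ge0 eps_le; lra.
have e0 : 0 <= eps * d%:R by rewrite mulr_ge0.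
have es : eps * d%:R <= 2 * (s * d%:R) by rewrite mulrA ler_wpM2r.
have sN u v : e = [set u; v] -> d%:R * (1 - 2 * s) <= (deg EK u)%:R ->
    s * d%:R * (~~ skew e)%:R <= (deg EK v)%:R.
  move=> euv hu; have [_|/existsPn/(_ v)/existsPn/(_ u)] := boolP (skew e).
    by rewrite mulr0.
  by rewrite euv setUC eqxx hu /= -ltNge mulr1 mulrC => /ltW.
rewrite -(ler_pM2r D_gt0) mulrDl mulrAC.
have [eK|eNK] := boolP (e \in EK); last first.
  have out v : v \in e -> v \notin cover (M :&: EK).
    move=> ve; apply/bigcupP => -[f]; rewrite inE => /andP[fM fK] vf.
    have [fe|fe] := eqVneq f e; first by rewrite -fe fK in eNK.
    by rewrite (disjointFr (trivIsetP tM _ _ fM eM fe) vf) in ve.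
  have [ae be] : a \in e /\ b \in e by rewrite eab !inE !eqxx orbT.
  rewrite !load_unmatched ?out // -mulrDl divfK ?gt_eqF //.
  have oriented u v : e = [set u; v] -> d%:R * (1 - eps) <= (deg EK u)%:R ->
      (1 - eps) * d%:R + s * d%:R * (~~ skew e)%:R <= (deg EK u)%:R + (deg EK v)%:R.
    move=> euv hu; have /(sN _ _ euv) : d%:R * (1 - 2 * s) <= (deg EK u)%:R by lra.
    by lra.
  case: kernelK => _ _ /(_ e); rewrite inE eNK eE => /(_ isT)[v].
  rewrite eab !inE -eab => /predU1P[->|/eqP->]; first exact: oriented.
  by rewrite [_ + (deg EK b)%:R]addrC; apply: oriented; rewrite setUC.
have oriented u v : e = [set u; v] -> u != v -> (deg EK v <= deg EK u)%N ->
    (1 - eps) * d%:R + s * d%:R * (~~ skew e)%:R <= (y u + y v) * d%:R.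
  move=> euv uv vu.
  have [ue ve] : u \in e /\ v \in e by rewrite euv !inE !eqxx orbT.
  have -> : (y u + y v) * d%:R = 2 * d%:R - (deg EK u)%:R + (deg EK v)%:R.
    rewrite !(load_matched e) // /kernel_weight eM euv big_setU1 ?inE //= big_set1.
    by rewrite (maxn_idPl vu); field; rewrite gt_eqF.
  have dv0 : 0 <= (deg EK v)%:R :> R by [].
  have := deg_kernel_le u.
  (* If even the larger degree is below d(1 - 2s), the total load already exceeds 1 + 2s. *)
  have [/(sN _ _ euv)|hu] := leP (d%:R * (1 - 2 * s)) (deg EK u)%:R; first by lra.
  have : s * d%:R * (~~ skew e)%:R <= s * d%:R by rewrite ler_piMr // lern1 leq_b1.
  by lra.
have [ba|/ltnW ab'] := leqP (deg EK b) (deg EK a); first exact: oriented.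
by rewrite [y a + _]addrC; apply: oriented; rewrite // 1?setUC // eq_sym.
Qed.

(** Edges of [M] are disjoint, so their loads sum to at most the total load, which is twice the
    total weight. *)
Lemma skew_count :
  (1 - eps) * #|M|%:R + s * #|[set e in M | ~~ skew e]|%:R
    <= 2 * (1 + d%:R^-1) * (mu EK)%:R.
Proof.
have [/subsetP ME tM] := andP mM.
have [KE _ _] := kernelK.
have sK : simple_graph EK by move=> e /(subsetP KE)/sE.
apply: (@le_trans _ _ (\sum_(e in M) \sum_(v in e) y v)).
  apply: le_trans (ler_sum _ matching_edge_load).
  rewrite big_split /= sumr_const -[X in _ <= X + _]mulr_natr lerD2l -mulr_sumr -natr_sum.
  by rewrite card_set_filter.
rewrite -(big_trivIset _ tM) /=.
apply: (@le_trans _ _ (\sum_(v in [set: V]) y v)).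
  rewrite [leLHS]big_mkcond [leRHS]big_mkcond; apply: ler_sum => v _.
  rewrite inE; case: ifP => // _; apply: sumr_ge0 => e _.
  exact: kernel_weight_ge0.
rewrite sum_load -mulrA.
have -> : \sum_(e in EK) kernel_weight e * #|e :&: [set: V]|%:R =
    2 * \sum_(e in EK) kernel_weight e.
  by rewrite mulr_sumr; apply: eq_bigr => e eK; rewrite setIT sK // mulrC.
rewrite ler_pM2l //; apply: (fractional_matching_le_mu _ _ _ (M :&: EK)) => //.
- by rewrite /is_matching subsetIr (trivIsetS (subsetIl _ _) tM).
- by rewrite invr_ge0.
- by move=> e _; apply: kernel_weight_ge0.
- move=> e; rewrite !inE => /andP[+ eK]; rewrite eK andbT /kernel_weight.
  by move/negPf ->.
- exact: load_kernel_weight_le1.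
Qed.

End Kernel.

(** * From unbalanced edges to the size of the first matching *)

Theorem theorem3p14 (R : realFieldType) (eps delta s : R)
  (heps : eps = 2 / 10 ^+ 8)
  (hdelta : delta = 2 / 10 ^+ 6)
  (hs : s = 2 / 10 ^+ 4)
  (n : nat) (hn : n%:R = 1 / eps)
  (d : nat) (hd : 1 / eps <= d%:R)
  (V : finType) (E EK : {set {set V}})
  (hE : simple_graph E)
  (hK : is_kernel eps d E EK)
  (hmu : (2 - delta) * (mu EK)%:R <= (mu E)%:R)
  (du : V -> V -> R)
  (hdu : approx_degrees (eps ^+ 2 * d%:R) EK du)
  (MH MSH : nat -> {set {set V}})
  (hMH : forall i : nat, (1 <= i <= n)%N ->
     approx_matching (3 / 2 + eps) (BH eps s d E du i) (MH i))
  (hMSH : forall i : nat, (1 <= i <= n)%N ->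
     approx_matching (3 / 2 + eps) (BSH eps s d E du i) (MSH i)) :
  (mu E)%:R <=
    (2 - delta) *
    (mu (EK :|: \bigcup_(1 <= i < n.+1) (MH i :|: MSH i)))%:R.
Proof.
have eps0 : 0 < eps by rewrite heps; lra.
have d_gt0 : (0 < d)%N.
  by rewrite -(ltr0n R); apply: lt_le_trans hd; rewrite divr_gt0.
have D_gt0 : 0 < d%:R :> R by rewrite ltr0n.
have n_gt0 : (1 <= n)%N.
  by rewrite -(ltr0n R) hn divr_gt0.
have dV : d%:R^-1 <= eps by rewrite invf_ple ?posrE // -div1r.
have [M mM cM] := mu_attained _ E.
have eps_s : eps <= 2 * s by rewrite heps hs; lra.
have count := skew_count _ _ _ s _ _ _ _ d_gt0 hE hK mM (ltW eps0) eps_s.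
pose good := [set e in M | skew _ _ s d EK e].
have [/subsetP ME tM] := andP mM.
(* For [i = 1] the slack in both thresholds is exactly the degree error [eps ^+ 2 * d]. *)
have goodB : is_matching (BH eps s d E du 1) good.
  apply/andP; split; last first.
    by apply: trivIsetS tM; apply/subsetP => e; rewrite inE => /andP[].
  apply/subsetP => e; rewrite !inE => /andP[/ME -> /existsP[a /existsP[b]]].
  case/and3P=> eab hb ha; apply/existsP; exists a; apply/existsP; exists b.
  by rewrite eab /=; have := hdu a b; have := hdu b a; lra.
have [/andP[MHB tMH] cMH] := hMH 1%N n_gt0.
pose A := \bigcup_(1 <= i < n.+1) (MH i :|: MSH i).
have MHA : is_matching (EK :|: A) (MH 1%N).
  rewrite /is_matching tMH andbT /A big_ltn // setUCA -setUA.
  exact: subsetUl.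
have hA : #|MH 1%N|%:R <= (mu (EK :|: A))%:R :> R by rewrite ler_nat matching_le_mu.
have hgood : #|good|%:R <= (mu (BH eps s d E du 1))%:R :> R.
  by rewrite ler_nat matching_le_mu.
have split_M : #|M|%:R = #|good|%:R + #|[set e in M | ~~ skew _ _ s d EK e]|%:R :> R.
  rewrite -natrD -(cardsID [set e | skew _ _ s d EK e] M).
  by congr (_ + _)%:R; apply: eq_card => e; rewrite !inE // andbC.
set bad := #|[set e in M | ~~ _]|%:R in count split_M.
have beta0 : 0 < 3 / 2 + eps by lra.
rewrite ler_pdivrMr // in cMH.
rewrite -cM in hmu *; rewrite -/A.
set m := #|M|%:R in count split_M hmu *; set k := (mu EK)%:R in count hmu.
set p := (mu (EK :|: A))%:R in hA *.
set q := (mu (BH _ _ _ _ _ _))%:R in cMH hgood.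
have k0 : 0 <= k by rewrite /k.
have {}count : (1 - eps) * m + s * bad <= 2 * (1 + eps) * k.
  by apply: le_trans count _; rewrite ler_wpM2r // ler_pM2l // lerD2l.
have : #|MH 1%N|%:R * (3 / 2 + eps) <= p * (3 / 2 + eps) by rewrite ler_pM2r.
(* Numerically [bad] is below 0.006 [m], so [p] is above 0.66 [m], and 0.66 (2 - [delta]) exceeds
   1. *)
by rewrite heps hdelta hs in count hmu cMH *; lra.
Qed.
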